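(* Let $g \ge 2$ be an integer, let $\ell$ be a prime number, and let $H_\ell \subset \mathrm{Sp}_{2g}(\mathbb{Z}_\ell)$ be a closed subgroup. If the mod-$\ell$ reduction of $H_\ell$ (the image of $H_\ell$ under $\mathrm{Sp}_{2g}(\mathbb{Z}_\ell) \to \mathrm{Sp}_{2g}(\mathbb{Z}/\ell\mathbb{Z})$) equals all of $\mathrm{Sp}_{2g}(\mathbb{Z}/\ell\mathbb{Z})$, then $H_\ell = \mathrm{Sp}_{2g}(\mathbb{Z}_\ell)$, and in particular, the mod-$\ell^k$ reduction of $H_\ell$ equals all of $\mathrm{Sp}_{2g}(\mathbb{Z}/\ell^k\mathbb{Z})$ for each positive integer $k$.
   Context: For a commutative ring $R$, $\mathrm{Sp}_{2g}(R)$ is the group of $M \in \mathrm{SL}_{2g}(R)$ with $M^T \Omega_{2g} M = \Omega_{2g}$, where $\Omega_{2g} = \begin{pmatrix} 0 & \mathrm{id}_g \\ -\mathrm{id}_g & 0\end{pmatrix}$. $\mathbb{Z}_\ell$ is the ring of $\ell$-adic integers, and ''closed'' refers to the $\ell$-adic topology on $\mathrm{Sp}_{2g}(\mathbb{Z}_\ell)$. The mod-$\ell^k$ reduction of $H_\ell$ is its image under the natural map $\mathrm{Sp}_{2g}(\mathbb{Z}_\ell) \to \mathrm{Sp}_{2g}(\mathbb{Z}/\ell^k\mathbb{Z})$. *)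

(* Defs.v *)
From HB Require Import structures.
From mathcomp Require Import all_boot all_order all_algebra.
From mathcomp Require Import all_classical all_reals all_analysis.

Set Implicit Arguments.
Unset Strict Implicit.
Unset Printing Implicit Defensive.

Import Order.TTheory GRing.Theory Num.Theory.
Local Open Scope classical_set_scope.
Local Open Scope ring_scope.

(* [zmod_red l k] is the reduction Z/l^(k+2) -> Z/l^(k+1).  Exponents start at
   1 because ['Z_1] is Z/2 in MathComp. *)
Definition zmod_red (l k : nat) (x : 'Z_(l ^ k.+2)) : 'Z_(l ^ k.+1) :=
  (x : nat)%:R.

Lemma Zp_trunc_dvd (l k : nat) :
  ((Zp_trunc (l ^ k.+1)).+2 %| (Zp_trunc (l ^ k.+2)).+2)%N.
Proof.
case: l => [|[|l]]; first by rewrite !exp0n.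
  by rewrite !exp1n.
have gt1 n : (1 < l.+2 ^ n.+1)%N by rewrite -{1}(expn0 l.+2) ltn_exp2l.
by rewrite !Zp_cast // dvdn_exp2l.
Qed.

Lemma zmod_red_nat (l k n : nat) : zmod_red (n%:R : 'Z_(l ^ k.+2)) = n%:R.
Proof.
apply/val_inj; rewrite /zmod_red !Zp_nat /= modn_dvdm //.
exact: Zp_trunc_dvd.
Qed.

Lemma zmod_redD (l k : nat) : {morph @zmod_red l k : x y / x + y}.
Proof.
move=> x y; rewrite -[x]natr_Zp -[y]natr_Zp -natrD.
by rewrite !zmod_red_nat natrD.
Qed.

Lemma zmod_redM (l k : nat) : {morph @zmod_red l k : x y / x * y}.
Proof.
move=> x y; rewrite -[x]natr_Zp -[y]natr_Zp -natrM.
by rewrite !zmod_red_nat natrM.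
Qed.

Lemma zmod_red0 (l k : nat) : zmod_red (0 : 'Z_(l ^ k.+2)) = 0.
Proof. exact: (zmod_red_nat l k 0). Qed.

Lemma zmod_red1 (l k : nat) : zmod_red (1 : 'Z_(l ^ k.+2)) = 1.
Proof. exact: (zmod_red_nat l k 1). Qed.

Lemma zmod_redN (l k : nat) : {morph @zmod_red l k : x / - x}.
Proof.
by move=> x; apply/eqP; rewrite -addr_eq0 -zmod_redD addNr zmod_red0.
Qed.

(* The ring of l-adic integers, as the inverse limit of the rings Z/l^(k+1).
   The structures below exist for every [l : nat]; the intended reading is for
   [l] prime ([l >= 2] is needed for ['Z_(l ^ k.+1)] to be Z/l^(k+1)). *)
Record padic_int (l : nat) := PadicInt {
  padic_seq : forall k : nat, 'Z_(l ^ k.+1);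
  padic_compat : forall k, zmod_red (padic_seq k.+1) = padic_seq k
}.

(* Reduction modulo l^(k+1). *)
Definition padic_res (l k : nat) (x : padic_int l) : 'Z_(l ^ k.+1) :=
  padic_seq x k.

Lemma padic_intP (l : nat) (x y : padic_int l) :
  (forall k, padic_res k x = padic_res k y) -> x = y.
Proof.
case: x y => [x cx] [y cy]; rewrite /padic_res /= => xy.
have {}xy : x = y by exact: functional_extensionality_dep.
by subst y; congr PadicInt; exact: Prop_irrelevance.
Qed.

Section PadicRing.
Variable l : nat.
Implicit Types x y z : padic_int l.

Definition padic_zero : padic_int l :=
  @PadicInt l (fun=> 0) (fun k => zmod_red0 l k).

Definition padic_one : padic_int l :=
  @PadicInt l (fun=> 1) (fun k => zmod_red1 l k).

Program Definition padic_add x y : padic_int l :=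
  @PadicInt l (fun k => padic_seq x k + padic_seq y k) _.
Next Obligation. by move=> x y k; rewrite zmod_redD !padic_compat. Qed.

Program Definition padic_opp x : padic_int l :=
  @PadicInt l (fun k => - padic_seq x k) _.
Next Obligation. by move=> x k; rewrite zmod_redN !padic_compat. Qed.

Program Definition padic_mul x y : padic_int l :=
  @PadicInt l (fun k => padic_seq x k * padic_seq y k) _.
Next Obligation. by move=> x y k; rewrite zmod_redM !padic_compat. Qed.

HB.instance Definition _ := gen_eqMixin (padic_int l).
HB.instance Definition _ := gen_choiceMixin (padic_int l).

Lemma padic_addA : associative padic_add.
Proof. by move=> x y z; apply: padic_intP => k; exact: addrA. Qed.

Lemma padic_addC : commutative padic_add.
Proof. by move=> x y; apply: padic_intP => k; exact: addrC. Qed.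

Lemma padic_add0 : left_id padic_zero padic_add.
Proof. by move=> x; apply: padic_intP => k; exact: add0r. Qed.

Lemma padic_addN : left_inverse padic_zero padic_opp padic_add.
Proof. by move=> x; apply: padic_intP => k; exact: addNr. Qed.

HB.instance Definition _ := GRing.isZmodule.Build (padic_int l)
  padic_addA padic_addC padic_add0 padic_addN.

Lemma padic_mulA : associative padic_mul.
Proof. by move=> x y z; apply: padic_intP => k; exact: mulrA. Qed.

Lemma padic_mulC : commutative padic_mul.
Proof. by move=> x y; apply: padic_intP => k; exact: mulrC. Qed.

Lemma padic_mul1 : left_id padic_one padic_mul.
Proof. by move=> x; apply: padic_intP => k; exact: mul1r. Qed.

Lemma padic_mulDl : left_distributive padic_mul +%R.
Proof. by move=> x y z; apply: padic_intP => k; exact: mulrDl. Qed.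

Lemma padic_one_neq0 : padic_one != 0.
Proof.
apply/eqP => /(congr1 (padic_res 0)) /eqP.
by rewrite /padic_res /= oner_eq0.
Qed.

HB.instance Definition _ := GRing.Zmodule_isComNzRing.Build (padic_int l)
  padic_mulA padic_mulC padic_mul1 padic_mulDl padic_one_neq0.

Definition padic_unit : {pred padic_int l} :=
  fun x => `[< exists y, y * x = 1 >].

Definition padic_inv x : padic_int l :=
  if pselect (exists y, y * x = 1) is left e then projT1 (cid e) else x.

Lemma padic_mulVx : {in padic_unit, left_inverse 1 padic_inv *%R}.
Proof.
move=> x /asboolP ux; rewrite /padic_inv.
by case: pselect => // e; case: cid.
Qed.

Lemma padic_unitPl x y : y * x = 1 -> padic_unit x.
Proof. by move=> yx; apply/asboolP; exists y. Qed.

Lemma padic_invr_out : {in [predC padic_unit], padic_inv =1 id}.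
Proof.
move=> x /asboolP ux; rewrite /padic_inv.
by case: pselect.
Qed.

HB.instance Definition _ := GRing.ComNzRing_hasMulInverse.Build (padic_int l)
  padic_mulVx padic_unitPl padic_invr_out.

Fact padic_res_zmod k : zmod_morphism (@padic_res l k).
Proof. by []. Qed.

Fact padic_res_monoid k : monoid_morphism (@padic_res l k).
Proof. by []. Qed.

HB.instance Definition _ k := GRing.isZmodMorphism.Build
  (padic_int l) 'Z_(l ^ k.+1) (@padic_res l k) (padic_res_zmod k).
HB.instance Definition _ k := GRing.isMonoidMorphism.Build
  (padic_int l) 'Z_(l ^ k.+1) (@padic_res l k) (padic_res_monoid k).

End PadicRing.

(* The l-adic topology: the cosets x + l^k Z_l form a basis of neighborhoods
   of x. *)
Definition padic_coset (l : nat) (x : padic_int l) (k : nat) :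
    set (padic_int l) :=
  [set x + l%:R ^+ k * z | z in [set: padic_int l]].

Definition padic_nbhs (l : nat) (x : padic_int l) : set_system (padic_int l) :=
  filter_from [set: nat] (padic_coset x).

Section PadicTopology.
Variable l : nat.
Implicit Types (x y : padic_int l) (A : set (padic_int l)).

HB.instance Definition _ := hasNbhs.Build (padic_int l) (@padic_nbhs l).

Lemma padic_coset_refl x k : padic_coset x k x.
Proof. by exists 0; rewrite // mulr0 addr0. Qed.

Lemma padic_coset_le x j k : (j <= k)%N -> padic_coset x k `<=` padic_coset x j.
Proof.
move=> jk _ [z _ <-]; exists (l%:R ^+ (k - j) * z) => //.
by rewrite mulrA -exprD subnKC.
Qed.

Lemma padic_coset_trans x y k :
  padic_coset x k y -> padic_coset y k `<=` padic_coset x k.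
Proof. by move=> [z _ <-] _ [t _ <-]; exists (z + t); rewrite // mulrDr addrA. Qed.

Lemma padic_nbhs_filter x : ProperFilter (nbhs x).
Proof.
apply: filter_from_proper; last by move=> k _; exists x; exact: padic_coset_refl.
apply: filter_from_filter; first by exists 0%N.
move=> i j _ _; exists (maxn i j) => // y xy; split.
  by apply: padic_coset_le xy; rewrite leq_maxl.
by apply: padic_coset_le xy; rewrite leq_maxr.
Qed.

Lemma padic_nbhs_singleton x A : nbhs x A -> A x.
Proof. by move=> [k _]; apply; exact: padic_coset_refl. Qed.

Lemma padic_nbhs_nbhs x A : nbhs x A -> nbhs x (nbhs^~ A).
Proof.
move=> [k _ kA]; exists k => // y xy; exists k => //.
exact: subset_trans (padic_coset_trans xy) kA.
Qed.

HB.instance Definition _ := Nbhs_isNbhsTopological.Build (padic_int l)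
  padic_nbhs_filter padic_nbhs_singleton padic_nbhs_nbhs.

End PadicTopology.

Definition Omega (R : comNzRingType) (g : nat) : 'M[R]_(g + g) :=
  block_mx 0 1%:M (- 1%:M) 0.

Definition Sp (R : comNzRingType) (g : nat) : set 'M[R]_(g + g) :=
  [set M | \det M = 1 /\ M^T *m Omega R g *m M = Omega R g].
Arguments Sp R g : clear implicits.

Definition is_subgroup_Sp (R : comUnitRingType) (g : nat)
    (H : set 'M[R]_(g + g)) : Prop :=
  [/\ H `<=` Sp R g,
      H 1%:M,
      forall A B, H A -> H B -> H (A *m B) &
      forall A, H A -> H (invmx A)].

(* Closed in the subspace topology which Sp_2g(Z_l) inherits from the entrywise
   (product) topology on matrices. *)
Definition is_closed_in_Sp (l g : nat)
    (H : set 'M[padic_int l]_(g + g)) : Prop :=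
  closed (H : set (subspace (Sp (padic_int l) g))).

(* The image of H in the matrices over Z/l^(k+1). *)
Definition mod_reduction (l g k : nat) (H : set 'M[padic_int l]_(g + g)) :
    set 'M['Z_(l ^ k.+1)]_(g + g) :=
  [set map_mx (@padic_res l k) M | M in H].
Arguments mod_reduction {l g} k H.

(* Main.v *)
(* Write [<v, w>] for the symplectic form, [bil v v] for the endomorphism
   [x |-> <v, x> v], and [level k] for the set of residues modulo l of those Y
   with [1 + l^k Y] in H. For k > 0 it is an Sp(F_l)-stable subspace of the Lie
   algebra sp(F_l), and the theorem follows by successive approximation once it
   is shown to be all of sp(F_l).

   An Sp(F_l)-stable subspace containing some A with [<w, A w> <> 0] for some w
   is everything: conjugating by transvections one reaches some [bil y y] with
   y nonzero, hence all [bil v v], which span sp(F_l). This works uniformly in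
   l, including l = 2, and uses g >= 2. Since [bil v v] squares to 0, raising to
   the l-th power passes from [level k] to [level k.+1].

   To start at k = 1, suppose that [<w, A w> = 0] for all w and all A in
   [level 1]. Lift the transvections along e_0, e_1 and e_0 + e_1 to H, writing
   the lift along v as [T_v (1 + l X_v)]. These transvections commute, so the
   commutators of the lifts are congruent to 1 modulo l; testing them against
   three vectors gives [<e_0, X e_0> = 0] for X the residue of [X_(e_0)]. Then
   the l-th power of the lift along e_0 yields an A in [level 1] with
   [<x, A x> = - <e_0, x>^2], a contradiction. *)

From HB Require Import structures.
Require Import Defs.
From mathcomp Require Import all_boot all_order all_algebra.
From mathcomp Require Import all_classical all_reals all_analysis.
From mathcomp Require Import ring.

Set Implicit Arguments.
Unset Strict Implicit.
Unset Printing Implicit Defensive.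

Import GRing.Theory.
Local Open Scope classical_set_scope.
Local Open Scope ring_scope.

(** * The symplectic form and transvections *)

(** Two block-triangular factorisations of one matrix are compared, so the identity holds over any
    commutative ring. It gives transvections determinant 1. *)
Lemma det_add1_mulmx (R : comNzRingType) (n : nat) (u : 'cV[R]_n)
    (v : 'rV[R]_n) :
  \det (1%:M + u *m v) = 1 + (v *m u) 0 0.
Proof.
have e1 : block_mx 1%:M (- u) v 1%:M =
    block_mx 1%:M 0 v 1%:M *m block_mx 1%:M (- u) 0 (1%:M + v *m u).
  rewrite mulmx_block !mul1mx !mul0mx ?mulmx0 ?mulmx1 !addr0 mulmxN.
  by rewrite addrCA addNr addr0.
have e2 : block_mx 1%:M (- u) v 1%:M =
    block_mx (1%:M + u *m v) (- u) 0 1%:M *m block_mx 1%:M 0 v 1%:M.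
  by rewrite mulmx_block !mulmx1 !mul0mx !mulmx0 !mul1mx !add0r mulNmx addrK.
have := congr1 determinant e1.
rewrite {1}e2 !det_mulmx !det_lblock !det_ublock !det1 !mul1r !mulr1 => ->.
by rewrite det_mx11 !mxE eqxx.
Qed.

Lemma mulmx_cV_inj (R : comNzRingType) (m n : nat) (A B : 'M[R]_(m, n)) :
  (forall x : 'cV_n, A *m x = B *m x) -> A = B.
Proof. 
move=> AB; apply/matrixP => i j.
by have := AB (delta_mx j 0); rewrite -!colE => /colP/(_ i); rewrite !mxE.
Qed.

Section Symplectic.
Variables (R : comNzRingType) (g : nat).
Implicit Types (u v w x y : 'cV[R]_(g + g)) (c : R) (A B M t : 'M[R]_(g + g)).
Local Notation Om := (Omega R g).

Lemma tr_Omega : Om^T = - Om.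
Proof.
rewrite /Omega tr_block_mx !trmx0 trmx1 linearN /= trmx1 opp_block_mx.
by rewrite !oppr0 opprK.
Qed.

Lemma Omega_sqr : Om *m Om = - 1%:M.
Proof.
rewrite /Omega mulmx_block !mul0mx !mulmx0 !mul1mx !mulmx1 !addr0 !add0r.
by rewrite [in RHS]scalar_mx_block opp_block_mx !oppr0.
Qed.

Definition form v w : R := (v^T *m Om *m w) 0 0.

Lemma formE v w : v^T *m Om *m w = (form v w)%:M.
Proof. exact: mx11_scalar. Qed.

Lemma formDl u v w : form (u + v) w = form u w + form v w.
Proof. by rewrite /form linearD /= !mulmxDl mxE. Qed.
Lemma formDr u v w : form u (v + w) = form u v + form u w.
Proof. by rewrite /form mulmxDr mxE. Qed.
Lemma formZl c v w : form (c *: v) w = c * form v w.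
Proof. by rewrite /form linearZ /= -!scalemxAl mxE. Qed.
Lemma formZr c v w : form v (c *: w) = c * form v w.
Proof. by rewrite /form -scalemxAr mxE. Qed.
Lemma formNl v w : form (- v) w = - form v w.
Proof. by rewrite -scaleN1r formZl mulN1r. Qed.
Lemma formNr v w : form v (- w) = - form v w.
Proof. by rewrite -scaleN1r formZr mulN1r. Qed.

Definition form_linear := (formDr, formDl, formZr, formZl, formNr, formNl).

Lemma formC v w : form v w = - form w v.
Proof.
have -> : form v w = (v^T *m Om *m w)^T 0 0 by rewrite mxE.
by rewrite !trmx_mul trmxK tr_Omega mulNmx mulmxN mxE mulmxA.
Qed.

(** The two contributions of the halves of [v] are transposes of each other up to sign and cancel.
    Unlike an argument from antisymmetry, this covers characteristic 2. *)
Lemma formvv v : form v v = 0.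
Proof.
rewrite /form -[v]vsubmxK tr_col_mx /Omega mul_row_block !mulmx0 !mulmx1.
rewrite mulmxN mulmx1 add0r addr0 mul_row_col mulNmx.
rewrite mxE [X in X + _]mxE.
have -> : ((usubmx v)^T *m dsubmx v) 0 0 = ((usubmx v)^T *m dsubmx v)^T 0 0.
  by rewrite [RHS]mxE.
by rewrite trmx_mul trmxK addNr.
Qed.

Lemma form_mulmx M v w : Sp R g M -> form (M *m v) (M *m w) = form v w.
Proof.
case=> _ MO; rewrite /form trmx_mul -!mulmxA (mulmxA Om) (mulmxA M^T).
by rewrite (mulmxA M^T Om) MO.
Qed.

Definition bil v w : 'M[R]_(g + g) := v *m w^T *m Om.

Lemma bilE v w x : bil v w *m x = form w x *: v.
Proof. by rewrite /bil -!mulmxA (mulmxA w^T) formE mul_mx_scalar. Qed.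

Lemma bilDl u v w : bil (u + v) w = bil u w + bil v w.
Proof. by rewrite /bil !mulmxDl. Qed.
Lemma bilDr u v w : bil u (v + w) = bil u v + bil u w.
Proof. by rewrite /bil linearD /= mulmxDr mulmxDl. Qed.
Lemma bilZl c v w : bil (c *: v) w = c *: bil v w.
Proof. by rewrite /bil -!scalemxAl. Qed.
Lemma bilZr c v w : bil v (c *: w) = c *: bil v w.
Proof. by rewrite /bil linearZ /= -scalemxAr -!scalemxAl. Qed.
Lemma bilNl v w : bil (- v) w = - bil v w.
Proof. by rewrite -scaleN1r bilZl scaleN1r. Qed.
Lemma bilNr v w : bil v (- w) = - bil v w.
Proof. by rewrite -scaleN1r bilZr scaleN1r. Qed.

Lemma bilMbil u v w x : bil u v *m bil w x = form v w *: bil u x.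
Proof.
apply: mulmx_cV_inj => y.
by rewrite -mulmxA !bilE -scalemxAl !bilE formZr scalerA mulrC.
Qed.

Definition transvection c u : 'M[R]_(g + g) := 1%:M + c *: bil u u.

Lemma transvectionE c u x : transvection c u *m x = x + (c * form u x) *: u.
Proof. by rewrite mulmxDl mul1mx -scalemxAl bilE scalerA. Qed.

Lemma transvectionK c u : transvection c u *m transvection (- c) u = 1%:M.
Proof.
rewrite /transvection mulmxDl mul1mx mulmxDr mulmx1 -scalemxAr -scalemxAl bilMbil.
by rewrite formvv scale0r !scaler0 addr0 scaleNr addrNK.
Qed.

Lemma transvectionC c d u v : form u v = 0 ->
  transvection c u *m transvection d v = transvection d v *m transvection c u.
Proof.
move=> uv; have vu : form v u = 0 by rewrite formC uv oppr0.
apply: mulmx_cV_inj => x; rewrite -!mulmxA !transvectionE !formDr !formZr uv vu.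
by rewrite !mulr0 !addr0 addrAC.
Qed.

Lemma bilinear_mx_inj A B :
  (forall x y, (x^T *m A *m y) 0 0 = (x^T *m B *m y) 0 0) -> A = B.
Proof.
move=> AB; apply/matrixP => i j; have := AB (delta_mx i 0) (delta_mx j 0).
by rewrite !trmx_delta -!mulmxA -!colE -!rowE !mxE.
Qed.

Lemma SpP M : \det M = 1 -> (forall x y, form (M *m x) (M *m y) = form x y) ->
  Sp R g M.
Proof.
move=> dM MF; split=> //; apply: bilinear_mx_inj => x y; rewrite -[RHS]MF /form.
by rewrite trmx_mul !mulmxA.
Qed.

Lemma transvection_Sp c u : Sp R g (transvection c u).
Proof.
apply: SpP => [|x y].
  rewrite /transvection /bil -mulmxA scalemxAl det_add1_mulmx.
  rewrite -[_ *m (c *: u)]scalemxAr mxE -[X in _ + _ * X]/(form u u).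
  by rewrite formvv mulr0 addr0.
rewrite !transvectionE !formDl !formDr !formZl !formZr formvv (formC x u).
by ring.
Qed.

Lemma Sp_mulmx A B : Sp R g A -> Sp R g B -> Sp R g (A *m B).
Proof.
case=> dA fA [dB fB]; split; first by rewrite det_mulmx dA dB mulr1.
by rewrite trmx_mul -!mulmxA (mulmxA Om) (mulmxA A^T) (mulmxA A^T Om) fA mulmxA.
Qed.

Lemma form_delta i j : form (delta_mx i 0) (delta_mx j 0) = Om i j.
Proof. by rewrite /form trmx_delta -rowE -colE !mxE. Qed.

Definition sp A := forall x y, form (A *m x) y = - form x (A *m y).

Lemma sp_form_sym A x y : sp A -> form x (A *m y) = form y (A *m x).
Proof. by move=> spA; rewrite -[LHS]opprK -spA -formC. Qed.

Lemma sp_mxP A : sp A <-> A^T *m Om = - (Om *m A).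
Proof.
split=> [spA|AO x y].
  apply: bilinear_mx_inj => x y; have := spA x y; rewrite /form => spAxy.
  by rewrite mulmxA -trmx_mul spAxy mulmxN mulNmx [RHS]mxE !mulmxA.
by rewrite /form trmx_mul -(mulmxA x^T A^T) AO mulmxN mulNmx [LHS]mxE !mulmxA.
Qed.

End Symplectic.

(** * Stable subspaces of the symplectic Lie algebra *)

Section SubmoduleGeneration.
Variables (F : fieldType) (g : nat) (L : 'M[F]_(g + g) -> Prop).
Hypothesis LD : forall A B, L A -> L B -> L (A + B).
Hypothesis LZ : forall c A, L A -> L (c *: A).
Hypothesis LJ : forall t A, Sp F g t -> L A -> L (t *m A *m invmx t).
Implicit Types (u v w x y s : 'cV[F]_(g + g)) (A B t : 'M[F]_(g + g)).

Lemma stable_opp A : L A -> L (- A).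
Proof. by move=> LA; rewrite -scaleN1r; apply: LZ. Qed.

Lemma stable_sub A B : L A -> L B -> L (A - B).
Proof. by move=> LA LB; apply: LD => //; apply: stable_opp. Qed.

Lemma bil_conj t v w :
  Sp F g t -> t *m bil v w *m invmx t = bil (t *m v) (t *m w).
Proof.
case=> dt tO; have ut : t \in unitmx by rewrite unitmxE dt unitr1.
by rewrite /bil trmx_mul -{1}tO !mulmxA mulmxK.
Qed.

Lemma invmx_transvection c u :
  invmx (transvection c u) = transvection (- c) u.
Proof.
have [dt _] := transvection_Sp c u.
have ut : transvection c u \in unitmx by rewrite unitmxE dt unitr1.
by rewrite -[RHS](mulKmx ut) transvectionK mulmx1.
Qed.

(** Reading [bil] as a tensor product, this is the symmetric tensor [ws + sw + ww]; it is used when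
    [w] and [s] form a hyperbolic pair. *)
Definition hyp_elt w s : 'M[F]_(g + g) := bil w s + bil s w + bil w w.

Lemma hyp_elt_conj t w s :
  Sp F g t -> L (hyp_elt w s) -> L (hyp_elt (t *m w) (t *m s)).
Proof.
by move=> St /(LJ St); rewrite /hyp_elt !mulmxDr !mulmxDl !bil_conj.
Qed.

(* The element is a scalar multiple of [t A t^-1 - A], with [t] the transvection
   along w; s is a multiple of [A w]. *)
Lemma hyp_elt_mem A w : L A -> sp A -> form w (A *m w) != 0 ->
  exists2 s, form w s = 1 & L (hyp_elt w s).
Proof.
move=> LA spA; set s := A *m w; set a := form w s => a0.
exists (a^-1 *: s); first by rewrite formZr mulVf.
have -> : hyp_elt w (a^-1 *: s) =
    (- a^-1) *: (transvection 1 w *m A *m invmx (transvection 1 w) - A).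
  rewrite invmx_transvection; apply: mulmx_cV_inj => x.
  rewrite -scalemxAl mulmxBl -!mulmxA !transvectionE mulmxDr -scalemxAr -/s.
  rewrite !mulmxDl !bilE formDr !formZl formZr -/a.
  rewrite -(sp_form_sym x w spA) -[form x (A *m w)]/(form x s) (formC x s).
  set sx := form s x; set wx := form w x; set Ax := A *m x.
  by apply/colP => i; rewrite !mxE; field.
by apply: LZ; apply: stable_sub => //; apply: LJ => //; exact: transvection_Sp.
Qed.

Lemma exists_form_neq0 v : v != 0 -> exists z, form v z != 0.
Proof.
case: (pickP (fun j => form v (delta_mx j 0) != 0)) => [j vj|vz].
  by exists (delta_mx j 0).
have vO : v^T *m Omega F g = 0.
  apply/rowP => j; have /negbFE/eqP := vz j.
  by rewrite /form -colE mxE => ->; rewrite mxE.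
case/eqP; apply: trmx_inj; rewrite trmx0 -[LHS]mulmx1 -[1%:M]opprK -Omega_sqr.
by rewrite mulmxN mulmxA vO mul0mx oppr0.
Qed.

(** When [v] and [w] are not orthogonal, a transvection along [w - v] carries [v] to [w]. *)
Lemma sq_mem_step v w : L (bil v v) -> form v w != 0 -> L (bil w w).
Proof.
move=> Lv vw; pose t := transvection (form w v)^-1 (w - v).
have wv : form w v != 0 by rewrite formC oppr_eq0.
have <- : t *m v = w.
  rewrite transvectionE formDl formNl formvv subr0 mulVf // scale1r.
  by rewrite addrC subrK.
by rewrite -bil_conj; [apply: LJ => //|]; exact: transvection_Sp.
Qed.

(** Two steps through a vector [z] orthogonal to neither [v] nor [w]; such a [z] exists because a
    vector space is not the union of two hyperplanes. *)
Lemma sq_mem v w : L (bil v v) -> v != 0 -> L (bil w w).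
Proof.
move=> Lv v0; have [->|w0] := eqVneq w 0.
  by rewrite /bil !mul0mx -(scale0r (bil v v)); apply: LZ.
have [z1 vz1] := exists_form_neq0 v0; have [z2 wz2] := exists_form_neq0 w0.
suff [z vz wz] : exists2 z, form v z != 0 & form w z != 0.
  by apply: (@sq_mem_step z); [exact: sq_mem_step vz|rewrite formC oppr_eq0].
have [wz1|] := eqVneq (form w z1) 0; last by exists z1.
have [vz2|] := eqVneq (form v z2) 0; last by exists z2.
by exists (z1 + z2); rewrite formDr ?wz1 ?vz2 ?add0r ?addr0.
Qed.

(** The shear [s |-> s + y] changes the given element by [wy + yw], and a Weyl element turns this
    into [sy + ys]. The Weyl element also produces [ww + ss], which the shear changes by
    [sy + ys + yy]. Nothing is divided by 2. *)
Lemma hyp_elt_sq_mem w s y : L (hyp_elt w s) -> form w s = 1 ->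
  form w y = 0 -> form s y = 0 -> L (bil y y).
Proof.
move=> Lws ws wy sy.
have sw : form s w = -1 by rewrite formC ws.
have yw : form y w = 0 by rewrite formC wy oppr0.
have ys : form y s = 0 by rewrite formC sy oppr0.
have Stv c u := transvection_Sp c (u : 'cV[F]_(g + g)).
have swap u v : form u v = 1 -> form u y = 0 -> form v y = 0 ->
    exists2 t, Sp F g t & [/\ t *m u = - v, t *m v = u & t *m y = y].
  move=> uv uy vy; have vu : form v u = -1 by rewrite formC uv.
  (* The Weyl element of the hyperbolic plane spanned by u and v. *)
  exists (transvection 1 u *m transvection 1 v *m transvection 1 u).
    by do 2?[apply: Sp_mulmx => //].
  split; rewrite -!mulmxA !transvectionE ?(form_linear, formvv, uv, vu, uy, vy);
    by apply/colP => i; rewrite !mxE; ring.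
(* The factor along [w + y] adds [w + y] to [s]; the factor along [w] then removes the [w]. *)
have shear : exists2 t, Sp F g t & t *m w = w /\ t *m s = s + y.
  exists (transvection (-1) w *m transvection 1 (w + y)).
    exact: Sp_mulmx.
  split; rewrite -!mulmxA !transvectionE
    ?(form_linear, formvv, ws, sw, wy, yw, ys, sy);
    by apply/colP => i; rewrite !mxE; ring.
have [t1 St1 [t1w t1s t1y]] := swap _ _ ws wy sy.
have [t2 St2 [t2w t2s]] := shear.
have Lwy : L (bil w y + bil y w).
  have := stable_sub (hyp_elt_conj St2 Lws) Lws; rewrite t2w t2s; congr L.
  rewrite /hyp_elt bilDr bilDl; set a := bil w s; set b := bil s w.
  by apply/matrixP => i j; rewrite !mxE; ring.
have Lsy : L (bil s y + bil y s).
  have := LJ St1 Lwy; rewrite !mulmxDr !mulmxDl !bil_conj // t1w t1y.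
  by move/stable_opp; rewrite bilNl bilNr -opprD opprK.
have Lwwss : L (bil w w + bil s s).
  have := LD (hyp_elt_conj St1 Lws) Lws; rewrite t1w t1s; congr L.
  rewrite /hyp_elt !(bilNl, bilNr); set a := bil w s; set b := bil s w.
  by apply/matrixP => i j; rewrite !mxE; ring.
have := LJ St2 Lwwss; rewrite !mulmxDr !mulmxDl !bil_conj // t2w t2s.
move=> /stable_sub /(_ Lwwss) /stable_sub /(_ Lsy); congr L.
rewrite !(bilDl, bilDr).
by apply/matrixP => i j; rewrite !(mxE, bilDl, bilDr); ring.
Qed.

(** Two linear conditions on a space of dimension [2g >= 4] leave a nonzero solution. *)
Lemma exists_form_perp2 w s : (2 <= g)%N ->
  exists2 y, y != 0 & form w y = 0 /\ form s y = 0.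
Proof.
move=> g2; pose K := Omega F g *m row_mx w s.
have : kermx K != 0.
  rewrite -mxrank_eq0 mxrank_ker -lt0n subn_gt0.
  apply: leq_ltn_trans (rank_leq_col _) _.
  exact: leq_trans (leq_add g2 g2).
case/rowV0Pn => y yK y0; exists y^T.
  by rewrite -trmx0 (inj_eq trmx_inj).
move/sub_kermxP: yK; rewrite /K mul_mx_row mul_mx_row -row_mx0.
case/eq_row_mx=> yw ys.
by split; rewrite formC /form trmxK -mulmxA ?yw ?ys mxE oppr0.
Qed.

Lemma sp_sym A : sp A ->
  exists2 S : 'M[F]_(g + g), S^T = S & A = S *m Omega F g.
Proof.
move=> /sp_mxP AO; exists (- (A *m Omega F g)); last first.
  by rewrite mulNmx -mulmxA Omega_sqr mulmxN mulmx1 opprK.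
rewrite linearN /= trmx_mul tr_Omega mulNmx opprK.
have := congr1 (fun B => Omega F g *m B *m Omega F g) AO.
rewrite mulmxN mulNmx !mulmxA Omega_sqr mulNmx mul1mx mulNmx opprK => <-.
by rewrite -!mulmxA Omega_sqr !mulmxN mulmx1 opprK.
Qed.

(** Grouping the indices [(i, j)] and [(j, i)] lets a symmetric matrix be expanded without
    halving. *)
Lemma sum_sym_pairs n (V : zmodType) (f : 'I_n -> 'I_n -> V) :
  \sum_i \sum_j f i j =
  \sum_(i : 'I_n) (f i i + \sum_(j : 'I_n | (j < i)%N) (f i j + f j i)).
Proof.
rewrite big_split /=; under [X in _ + X]eq_bigr do rewrite big_split /=.
rewrite big_split /= [X in _ + (_ + X)](exchange_big_dep xpredT) //=.
rewrite -!big_split /=; apply: eq_bigr => i _.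
rewrite (bigD1 i) //= (bigID (fun j : 'I_n => (j < i)%N)) /=; congr (_ + (_ + _)).
  by apply: eq_bigl => j; case: eqP => [->|_] //=; rewrite ltnn.
by apply: eq_bigl => j; rewrite -leqNgt ltn_neqAle eq_sym.
Qed.

(** Elements of [sp] correspond to symmetric tensors. Diagonal terms are squares, and an
    off-diagonal pair is [(e_i + e_j)^2 - e_i^2 - e_j^2], in every characteristic. *)
Lemma sp_mem A v : L (bil v v) -> v != 0 -> sp A -> L A.
Proof.
move=> Lv v0 /sp_sym[S SS ->].
have Lsq w : L (bil w w) by exact: sq_mem Lv v0.
have Lsum I (r : seq I) (P : pred I) (f : I -> 'M[F]_(g + g)) :
    (forall i, P i -> L (f i)) -> L (\sum_(i <- r | P i) f i).
  move=> Lf; elim/big_ind: _ => //.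
  by rewrite -(scale0r (bil v v)); apply: LZ.
rewrite [S]matrix_sum_delta mulmx_suml.
pose e i : 'cV[F]_(g + g) := delta_mx i 0.
have eE i j : S i j *: delta_mx i j *m Omega F g = S i j *: bil (e i) (e j).
  by rewrite -scalemxAl /bil trmx_delta mul_delta_mx.
under eq_bigr do rewrite mulmx_suml.
rewrite sum_sym_pairs; apply: (Lsum) => i _; apply: LD.
  by rewrite eE; apply: LZ.
apply: Lsum => j _; rewrite !eE.
have -> : S j i = S i j by rewrite -[in LHS]SS mxE.
rewrite -scalerDr; apply: LZ.
have := stable_sub (stable_sub (Lsq (e i + e j)) (Lsq (e i))) (Lsq (e j)); congr L.
rewrite bilDl !bilDr.
by apply/matrixP => i' j'; rewrite !mxE; ring.
Qed.

Lemma sp_full A w : (2 <= g)%N -> L A -> sp A -> form w (A *m w) != 0 ->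
  forall B, sp B -> L B.
Proof.
move=> g2 LA spA wAw B; have [s ws Lws] := hyp_elt_mem LA spA wAw.
have [y y0 [wy sy]] := exists_form_perp2 w s g2.
exact: sp_mem (hyp_elt_sq_mem Lws ws wy sy) y0.
Qed.

End SubmoduleGeneration.

(** * Arithmetic of the l-adic integers *)

Section PadicArithmetic.
Variables (l : nat) (l_gt1 : (1 < l)%N).
Implicit Types (x y z : padic_int l) (k j : nat).

Lemma expl_gt1 k : (1 < l ^ k.+1)%N.
Proof. by rewrite -(exp1n k.+1) ltn_exp2r. Qed.

Lemma Zl_nat k (n : nat) : (n%:R : 'Z_(l ^ k.+1)) = (n %% l ^ k.+1)%N :> nat.
Proof. by rewrite val_Zp_nat // expl_gt1. Qed.

Lemma Zl_nat_eq k (m n : nat) :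
  (m%:R == n%:R :> 'Z_(l ^ k.+1)) = (m == n %[mod l ^ k.+1]).
Proof. by rewrite -val_eqE /= !Zl_nat. Qed.

Lemma padic_seq_modn x k :
  padic_seq x k = (padic_seq x k.+1 %% l ^ k.+1)%N :> nat.
Proof. by rewrite -[in LHS]padic_compat Zl_nat. Qed.

Lemma padic_seq_modnD x k m :
  padic_seq x k = (padic_seq x (k + m) %% l ^ k.+1)%N :> nat.
Proof.
elim: m => [|m IH].
  rewrite addn0 modn_small // -[X in (_ < X)%N]Zp_cast ?expl_gt1 //.
rewrite IH padic_seq_modn addnS modn_dvdm //.
by rewrite dvdn_exp2l // ltnS leq_addr.
Qed.

(** These are the components of [x / l^(k+1)]: dividing a representative modulo [l^(j+k+2)] leaves a
    residue modulo [l^(j+1)], hence the shift of index. *)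
Fact padic_divl_compat x k j :
  zmod_red ((padic_seq x (j.+1 + k.+1) %/ l ^ k.+1)%:R : 'Z_(l ^ j.+2)) =
  (padic_seq x (j + k.+1) %/ l ^ k.+1)%:R.
Proof.
rewrite zmod_red_nat; apply/eqP; rewrite Zl_nat_eq (padic_seq_modn x (j + k.+1)).
rewrite -[(j.+1 + k.+1)%N]/((j + k.+1).+1).
set N := nat_of_ord _; set e := (l ^ k.+1)%N.
have -> : (l ^ (j + k.+1).+1 = l ^ j.+1 * e)%N by rewrite -expnD addSn.
rewrite {1}(divn_eq N (l ^ j.+1 * e)) mulnA divnMDl ?modnMDl //.
by rewrite expn_gt0 (ltnW l_gt1).
Qed.

Lemma padic_res_eq0 k x : padic_res k x = 0 -> exists z, x = l%:R ^+ k.+1 * z.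
Proof.
move=> x0; exists (PadicInt (padic_divl_compat x k)).
apply: padic_intP => j; rewrite rmorphM rmorphXn rmorph_nat /padic_res /=.
rewrite -natrX -natrM mulnC divnK.
  rewrite -[LHS]natr_Zp; apply/eqP; rewrite Zl_nat_eq (padic_seq_modnD x j k.+1).
  by rewrite modn_mod.
(* The division is exact, since every later representative reduces to the zero component of index
   [k]. *)
by rewrite /dvdn addnS -addSn addnC -padic_seq_modnD; apply/eqP/(congr1 val x0).
Qed.

(** Precision is lost by one step: [l x_(j+1) = 0] modulo [l^(j+2)] only makes [x_(j+1)] divisible
    by [l^(j+1)], which says exactly [x_j = 0]. *)
Lemma padic_mulIl x : l%:R * x = 0 -> x = 0.
Proof.
move=> lx; apply: padic_intP => j; have := congr1 (padic_res j.+1) lx.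
rewrite rmorphM rmorph_nat !rmorph0 /= -[padic_res j.+1 x]natr_Zp -natrM => /eqP.
rewrite -(mulr0n 1) Zl_nat_eq mod0n; set a := nat_of_ord _.
rewrite expnS -muln_modr muln_eq0 gtn_eqF ?(ltnW l_gt1) //= => /eqP a0.
by apply: val_inj; exact: etrans (padic_seq_modn x j) a0.
Qed.

Lemma padic_mulIXl k x : l%:R ^+ k * x = 0 -> x = 0.
Proof. by elim: k => [|k IH]; rewrite ?mul1r // exprS -mulrA => /padic_mulIl. Qed.

Lemma padic_res_surj k (a : 'Z_(l ^ k.+1)) : exists x, padic_res k x = a.
Proof. by exists (a : nat)%:R; rewrite rmorph_nat natr_Zp. Qed.

Lemma Zl_unit (l_prime : prime l) (a : 'Z_(l ^ 1)) :
  a != 0 -> a \is a GRing.unit.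
Proof.
move=> a0; rewrite -[a]natr_Zp unitZpE ?expn1 // prime_coprime //.
apply: contraNN a0 => la; rewrite -[a]natr_Zp -(mulr0n 1) Zl_nat_eq mod0n.
by move: (nat_of_ord a) la => n; rewrite expn1.
Qed.

End PadicArithmetic.

(** The field structure is put on ['Z_(l ^ 1)] itself, the type in which reductions of index 0 live,
    so that results over fields apply without transport. *)
Definition Zl_field (l : nat) (l_prime : prime l) : fieldType :=
  HB.pack 'Z_(l ^ 1) (GRing.ComUnitRing_isField.Build 'Z_(l ^ 1)
    (Zl_unit (prime_gt1 l_prime) l_prime)).

(** * Compatibility of lifts of commuting transvections *)

Section ShearIdentity.
Variables (R : comNzRingType) (g : nat).
Implicit Types (v w x y : 'cV[R]_(g + g)) (A B : 'M[R]_(g + g)).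

Lemma form_shear A w x : sp A ->
  form (transvection 1 w *m x) (A *m (transvection 1 w *m x)) =
  form x (A *m x) + 2%:R * form w x * form w (A *m x)
  + form w x ^+ 2 * form w (A *m w).
Proof.
move=> spA; rewrite transvectionE mul1r mulmxDr -scalemxAr.
rewrite !(formDl, formDr, formZl, formZr) (sp_form_sym x w spA).
by ring.
Qed.

(* The hypothesis is what triviality of a commutator of lifts amounts to; the
   conclusions come from evaluating it at x, x + w and x + v. *)
Lemma shear_constraints A B v w x : sp A -> sp B ->
  (forall y, form (transvection 1 w *m y) (A *m (transvection 1 w *m y))
             - form y (A *m y) =
             form (transvection 1 v *m y) (B *m (transvection 1 v *m y))
             - form y (B *m y)) ->
  form v w = 0 -> form v x = 0 -> form w x = 1 ->
  [/\ 2%:R * form w (A *m w) = 0, 2%:R * form w (A *m v) = 0 &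
      2%:R * form w (A *m x) + form w (A *m w) = 0].
Proof.
move=> spA spB AB vw vx wx.
have wv : form w v = 0 by rewrite formC vw oppr0.
(* The transvection along [v] fixes every [y] orthogonal to [v], so the right-hand side vanishes
   there. *)
have {}AB y : form v y = 0 -> form w y = 1 ->
    2%:R * form w (A *m y) + form w (A *m w) = 0.
  move=> vy wy; have := AB y; rewrite !form_shear // vy wy => ABy.
  transitivity (2%:R * 0 * form v (B *m y) + 0 ^+ 2 * form v (B *m v)).
    have := ABy; set r := form y _; set q := form y _ => e.
    transitivity (r + 2%:R * 1 * form w (A *m y) + 1 ^+ 2 * form w (A *m w) - r).
      by ring.
    by rewrite e; ring.
  by ring.
have e0 := AB x vx wx.
have e1 : 2%:R * form w (A *m (x + w)) + form w (A *m w) = 0.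
  by apply: AB; rewrite formDr ?vx ?wx ?vw ?formvv addr0.
have e2 : 2%:R * form w (A *m (x + v)) + form w (A *m w) = 0.
  by apply: AB; rewrite formDr ?vx ?wx ?wv ?formvv addr0.
split=> //.
  transitivity (2%:R * form w (A *m (x + w)) + form w (A *m w)
    - (2%:R * form w (A *m x) + form w (A *m w))); last by rewrite e1 e0 subr0.
  by rewrite mulmxDr formDr; ring.
transitivity (2%:R * form w (A *m (x + v)) + form w (A *m w)
  - (2%:R * form w (A *m x) + form w (A *m w))); last by rewrite e2 e0 subr0.
by rewrite mulmxDr formDr; ring.
Qed.

(** For [l = 2] and [A] the residue of [X], the matrix is the residue of
    [((T_v (1 + 2 X))^2 - 1) / 2]. With [n = bil v v], the terms [nA] and [An] cancel by
    skew-adjointness, [nnA] vanishes since [n^2 = 0], and [nAn] since [form v (A v) = 0]. *)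
Lemma form_square_shear A v x : sp A -> form v (A *m v) = 0 ->
  form x ((bil v v + (bil v v *m (A + bil v v *m A)
                      + (A + bil v v *m A) *m bil v v)) *m x) = - form v x ^+ 2.
Proof.
move=> spA vAv; set n := bil v v.
have -> : (n + (n *m (A + n *m A) + (A + n *m A) *m n)) *m x =
    n *m x + (n *m (A *m x) + n *m (n *m (A *m x))
              + (A *m (n *m x) + n *m (A *m (n *m x)))).
  by rewrite mulmxDr !mulmxDl !mulmxA.
rewrite !bilE -!scalemxAr !(formDr, formZr) vAv formvv.
by rewrite (sp_form_sym x v spA) (formC x v); ring.
Qed.

End ShearIdentity.

(** The constraints for [w] and for [v + w] are combined. If 2 is invertible, subtracting the second
    ones gives [2 <v, A v> = 0]. If [2 = 0], the third ones say that [<w, A w>] and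
    [<v + w, A (v + w)>] vanish, and the cross terms in the latter add up to 0. *)
Lemma shear_vanish (F : fieldType) (g : nat) (A B B' : 'M[F]_(g + g))
    (v w x : 'cV[F]_(g + g)) : sp A -> sp B -> sp B' ->
  (forall y, form (transvection 1 w *m y) (A *m (transvection 1 w *m y))
             - form y (A *m y) =
             form (transvection 1 v *m y) (B *m (transvection 1 v *m y))
             - form y (B *m y)) ->
  (forall y, form (transvection 1 (v + w) *m y)
               (A *m (transvection 1 (v + w) *m y)) - form y (A *m y) =
             form (transvection 1 v *m y) (B' *m (transvection 1 v *m y))
             - form y (B' *m y)) ->
  form v w = 0 -> form v x = 0 -> form w x = 1 ->
  form v (A *m v) = 0.
Proof.
move=> spA spB spB' AB AB' vw vx wx.
have [e1 e2 e3] := shear_constraints spA spB AB vw vx wx.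
have [] := shear_constraints spA spB' AB' _ vx _.
- by rewrite formDr formvv add0r.
- by rewrite formDl vx add0r.
have wAv : form v (A *m w) = form w (A *m v) by rewrite sp_form_sym.
rewrite !(mulmxDr, formDl, formDr) wAv => _ e4 e5.
have [two0|two_neq0] := eqVneq (2%:R : F) 0.
  move: e3 e5; rewrite two0 !mul0r !add0r => ->; rewrite addr0.
  set a := form v _; set c := form w _ => acc.
  transitivity (a + c + c - 2%:R * c); first by ring.
  by rewrite acc two0 mul0r subr0.
apply: (mulfI two_neq0); rewrite mulr0 -e4 mulrDr e2 addr0.
by [].
Qed.

Lemma sp_bil (R : comNzRingType) (g : nat) (v : 'cV[R]_(g + g)) : sp (bil v v).
Proof. by move=> x y; rewrite !bilE formZl formZr (formC x v); ring. Qed.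

(** For the l-th powers taken below, only terms up to [Z^2] matter individually; divisibility of
    [Z^3] controls the rest, whatever [Q] is. *)
Lemma exprD1_order3 (A : pzRingType) (Z : A) n :
  exists Q, (1 + Z) ^+ n = 1 + Z *+ n + Z ^+ 2 *+ 'C(n, 2) + Z ^+ 3 * Q.
Proof.
elim: n => [|n [Q IH]]; first by exists 0; rewrite mulr0n bin0n mulr0 !addr0.
exists (Q + 1 *+ 'C(n, 2) + Q * Z).
have e : (1 + Z *+ n + Z ^+ 2 *+ 'C(n, 2) + Z ^+ 3 * Q) * Z =
    Z + Z ^+ 2 *+ n + Z ^+ 3 *+ 'C(n, 2) + Z ^+ 3 * (Q * Z).
  by rewrite !mulrDl mul1r !mulrnAl -expr2 -exprSr mulrA.
rewrite exprSr IH mulrDr mulr1 e binS bin1 mulrnDr mulrS !mulrDr mulrnAr mulr1.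
by rewrite [LHS](AC (4*4) ((1*(5*2))*(3*6)*(4*7*8)))%AC.
Qed.

(** * Reduction and congruences of l-adic matrices *)

Section PadicMatrices.
Variables (l g : nat) (l_prime : prime l).
Let l_gt1 := prime_gt1 l_prime.
Local Notation R := (padic_int l).
Local Notation F := 'Z_(l ^ 1).
Local Notation pi := (l%:R : R).
Local Notation red := (map_mx (@padic_res l 0)).
Implicit Types (A B P U W X Y Z : 'M[R]_(g + g)) (u v w : 'cV[R]_(g + g)).

Lemma map_Omega (R1 R2 : comNzRingType) (f : {rmorphism R1 -> R2}) :
  map_mx f (Omega R1 g) = Omega R2 g.
Proof. by rewrite /Omega map_block_mx map_mxN map_mx1 map_mx0. Qed.

Lemma map_form (R1 R2 : comNzRingType) (f : {rmorphism R1 -> R2})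
    (x y : 'cV[R1]_(g + g)) : form (map_mx f x) (map_mx f y) = f (form x y).
Proof. by rewrite /form -(map_Omega f) map_trmx -!map_mxM mxE. Qed.

Lemma map_bil (R1 R2 : comNzRingType) (f : {rmorphism R1 -> R2})
    (x y : 'cV[R1]_(g + g)) :
  map_mx f (bil x y) = bil (map_mx f x) (map_mx f y).
Proof. by rewrite /bil !map_mxM map_trmx map_Omega. Qed.

Lemma map_transvection (R1 R2 : comNzRingType) (f : {rmorphism R1 -> R2}) c
    (x : 'cV[R1]_(g + g)) :
  map_mx f (transvection c x) = transvection (f c) (map_mx f x).
Proof. by rewrite /transvection map_mxD map_mx1 map_mxZ map_bil. Qed.

Lemma map_Sp (R1 R2 : comNzRingType) (f : {rmorphism R1 -> R2})
    (A : 'M[R1]_(g + g)) : Sp R1 g A -> Sp R2 g (map_mx f A).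
Proof.
case=> dA OA; split; first by rewrite det_map_mx dA rmorph1.
by rewrite -(map_Omega f) map_trmx -!map_mxM OA.
Qed.

Lemma padic_mx_res_eq0 k m n (X : 'M[R]_(m, n)) :
  map_mx (@padic_res l k) X = 0 -> exists Y : 'M[R]_(m, n), X = pi ^+ k.+1 *: Y.
Proof.
move=> X0; have Xd i j : exists z, X i j = pi ^+ k.+1 * z.
  by apply: padic_res_eq0 => //; move/matrixP/(_ i j): X0; rewrite !mxE.
exists (\matrix_(i, j) projT1 (cid (Xd i j))).
by apply/matrixP => i j; rewrite !mxE; case: cid.
Qed.

Lemma padic_mx_scaleI k m n (X Y : 'M[R]_(m, n)) :
  pi ^+ k *: X = pi ^+ k *: Y -> X = Y.
Proof.
move=> XY; apply/matrixP => i j; apply/eqP; rewrite -subr_eq0; apply/eqP.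
apply: (@padic_mulIXl _ l_gt1 k); rewrite mulrBr.
by move/matrixP/(_ i j): XY; rewrite !mxE => ->; rewrite subrr.
Qed.

Lemma res_pi : padic_res 0 pi = 0.
Proof.
rewrite rmorph_nat; apply/eqP.
by rewrite -(mulr0n 1) Zl_nat_eq // expn1 modnn mod0n.
Qed.

Lemma res_piX k : padic_res k (pi ^+ k.+1) = 0.
Proof.
rewrite rmorphXn rmorph_nat -natrX; apply/eqP.
by rewrite -(mulr0n 1) Zl_nat_eq // modnn mod0n.
Qed.

Lemma padic_res_pred k (x : R) : padic_res k.+1 x = 0 -> padic_res k x = 0.
Proof. by rewrite /padic_res -(padic_compat x k) => ->; exact: zmod_red0. Qed.

Lemma red_piD A B : red (A + pi *: B) = red A.
Proof. by rewrite map_mxD map_mxZ /= res_pi scale0r addr0. Qed.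

Lemma red_piXD k A B : red (A + pi ^+ k.+1 *: B) = red A.
Proof. by rewrite exprS -scalerA red_piD. Qed.

Lemma gram_add1Z c Y :
  (1%:M + c *: Y)^T *m Omega R g *m (1%:M + c *: Y) =
  Omega R g + c *: (Y^T *m Omega R g + Omega R g *m Y)
  + (c * c) *: (Y^T *m Omega R g *m Y).
Proof.
have -> : (1%:M + c *: Y)^T = 1%:M + c *: Y^T.
  by rewrite linearD /= trmx1 linearZ.
rewrite !mulmxDl !mulmxDr !mul1mx mulmx1.
rewrite -!scalemxAl -!scalemxAr mulmx1 scalerA scalerDr !addrA.
by rewrite [_ + c *: (Omega R g *m Y) + _]addrAC.
Qed.

(** The linear term of the Gram matrix is isolated by dividing by [l^(k+1)]; the quadratic term
    keeps a factor [l]. Assuming only a congruence modulo [l^(k+2)] admits matrices that are not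
    symplectic over the l-adic integers. *)
Lemma sp_red k Y Q :
  (1%:M + pi ^+ k.+1 *: Y)^T *m Omega R g *m (1%:M + pi ^+ k.+1 *: Y) =
    Omega R g + pi ^+ k.+2 *: Q ->
  sp (red Y).
Proof.
rewrite gram_add1Z -addrA => /addrI e.
have e' : Y^T *m Omega R g + Omega R g *m Y =
    pi *: (Q - pi ^+ k *: (Y^T *m Omega R g *m Y)).
  apply: (@padic_mx_scaleI k.+1); rewrite scalerA -exprSr scalerBr -e scalerA.
  by rewrite -!exprD [(k.+2 + k)%N]addSnnS addrK.
apply/sp_mxP/eqP; rewrite -addr_eq0 -(map_Omega (@padic_res l 0)) map_trmx.
by rewrite -!map_mxM -map_mxD e' map_mxZ /= res_pi scale0r.
Qed.

End PadicMatrices.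

(** * The levels of a subgroup surjecting modulo l *)

Section LevelSubgroups.
Variables (l g : nat) (l_prime : prime l) (g_ge2 : (2 <= g)%N).
Local Notation R := (padic_int l).
Local Notation F := 'Z_(l ^ 1).
Local Notation pi := (l%:R : R).
Local Notation red := (map_mx (@padic_res l 0)).
Variable H : set 'M[R]_(g + g).
Hypothesis H_subgroup : is_subgroup_Sp H.
Hypothesis H_mod_l : mod_reduction 0 H = Sp F g.
Implicit Types (A B P S T U W X Y Z : 'M[R]_(g + g)) (u v w : 'cV[R]_(g + g)).

Definition level k : set 'M[F]_(g + g) :=
  [set C | exists2 Y : 'M[R]_(g + g), H (1%:M + pi ^+ k *: Y) & red Y = C].

Lemma subgroup_Sp A : H A -> Sp R g A.
Proof. by case: H_subgroup => HSp _ _ _; apply: HSp. Qed.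

Lemma subgroup_mul A B : H A -> H B -> H (A *m B).
Proof. by case: H_subgroup => _ _ HM _; apply: HM. Qed.

Lemma Sp_unitmx A : Sp R g A -> A \in unitmx.
Proof. by case=> dA _; rewrite unitmxE dA unitr1. Qed.

(* [P] stands in for [B], which it agrees with modulo l. *)
Lemma level_div k A B P W : H A -> H B -> P \in unitmx -> red B = red P ->
  A = B + pi ^+ k *: (P *m W) -> level k (red W).
Proof.
move=> HA HB uP BP AB; have uB := Sp_unitmx (subgroup_Sp HB).
exists (invmx B *m P *m W).
  have -> : 1%:M + pi ^+ k *: (invmx B *m P *m W) = invmx B *m A.
    by rewrite AB mulmxDr mulVmx // -scalemxAr mulmxA.
  by apply: subgroup_mul => //; case: H_subgroup => _ _ _; apply.
have e : red P *m red (invmx B *m P) = red P.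
  by rewrite -BP -map_mxM mulmxA mulmxV // mul1mx.
rewrite map_mxM; suff -> : red (invmx B *m P) = 1%:M by rewrite mul1mx.
have := congr1 (mulmx (red (invmx P))) e.
by rewrite mulmxA -map_mxM mulVmx // map_mx1 mul1mx.
Qed.

Lemma level0 k : level k 0.
Proof.
exists 0; last by rewrite map_mx0.
by rewrite scaler0 addr0; case: H_subgroup.
Qed.

(** In a product of two elements of [H] the cross term [YZ] keeps an extra factor [l^(k+1)], so it
    dies modulo [l]; this is where the level must be positive. *)
Lemma levelD k C D : level k.+1 C -> level k.+1 D -> level k.+1 (C + D).
Proof.
move=> [Y HY <-] [Z HZ <-].
exists (Y + Z + pi ^+ k.+1 *: (Y *m Z)); last by rewrite red_piXD // map_mxD.
have := subgroup_mul HY HZ; congr H.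
rewrite mulmxDl !mulmxDr !mul1mx mulmx1 -scalemxAl -scalemxAr !scalerDr !addrA.
by congr (_ + _); rewrite addrAC.
Qed.

Lemma levelZ k (c : F) C : level k.+1 C -> level k.+1 (c *: C).
Proof.
(* Every scalar in Z/l is a natural number, so closure under addition suffices. *)
move=> LC; rewrite -[c]natr_Zp scaler_nat; elim: (nat_of_ord c) => [|n IH].
  by rewrite mulr0n; apply: level0.
by rewrite mulrS; apply: levelD.
Qed.

Lemma level_conj k (t C : 'M[F]_(g + g)) :
  Sp F g t -> level k C -> level k (t *m C *m invmx t).
Proof.
rewrite -H_mod_l => -[A HA At] [Y HY <-].
have uA := Sp_unitmx (subgroup_Sp HA).
exists (A *m Y *m invmx A).
  have -> : 1%:M + pi ^+ k *: (A *m Y *m invmx A) =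
      A *m (1%:M + pi ^+ k *: Y) *m invmx A.
    by rewrite mulmxDr mulmxDl mulmx1 mulmxV // -scalemxAr -scalemxAl.
  apply: subgroup_mul; first exact: subgroup_mul.
  by case: H_subgroup => _ _ _; apply.
have At1 : t *m red (invmx A) = 1%:M by rewrite -At -map_mxM mulmxV // map_mx1.
have [ut _] := mulmx1_unit At1.
have -> : invmx t = red (invmx A).
  by rewrite -[LHS]mulmx1 -At1 mulKmx.
by rewrite !map_mxM At.
Qed.

Lemma level_sp k C : level k.+1 C -> sp C.
Proof.
move=> [Y HY <-]; have [_ YO] := subgroup_Sp HY.
by apply: (@sp_red _ _ l_prime k Y 0); rewrite scaler0 addr0.
Qed.

Lemma lift_transvection u :
  exists2 X, H (transvection 1 u *m (1%:M + pi *: X)) & sp (red X).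
Proof.
have : mod_reduction 0 H (red (transvection 1 u)).
  by rewrite H_mod_l; apply: map_Sp; exact: transvection_Sp.
case=> A HA At; pose t' := transvection (- 1) u.
have tt' : transvection 1 u *m t' = 1%:M by exact: transvectionK.
have t't : t' *m transvection 1 u = 1%:M by exact: mulmx1C.
have [] := @padic_mx_res_eq0 _ l_prime 0 _ _ (t' *m A - 1%:M).
  by rewrite map_mxB map_mxM At -map_mxM t't subrr.
move=> X; rewrite expr1 => tAX; have AX : 1%:M + pi *: X = t' *m A.
  by rewrite -tAX addrC subrK.
exists X; first by rewrite AX mulmxA tt' mul1mx.
have [|_ YO] := @Sp_mulmx _ _ t' A _ (subgroup_Sp HA); first exact: transvection_Sp.
by apply: (@sp_red _ _ l_prime 0 X 0); rewrite scaler0 addr0 expr1 AX.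
Qed.

(** The two orders of multiplication give [ST (1 + l (T' X T + X' + ...))] and
    [ST (1 + l (S' X' S + X + ...))]. Both products lie in [H], and [level_div] with [P = ST] reads
    off their quotient. *)
Lemma level1_commutator S S' T T' X X' :
  S *m T = T *m S -> S' *m S = 1%:M -> T' *m T = 1%:M ->
  H (S *m (1%:M + pi *: X)) -> H (T *m (1%:M + pi *: X')) ->
  level 1 (red ((T' *m X *m T - X) - (S' *m X' *m S - X'))).
Proof.
move=> comm SK TK HS HT.
have expand (t t' s Y Z : 'M[R]_(g + g)) : t' *m s = 1%:M -> s *m t' = 1%:M ->
  t *m (1%:M + pi *: Y) *m (s *m (1%:M + pi *: Z)) =
  t *m s *m (1%:M + pi *: (t' *m Y *m s + Z + pi *: (t' *m Y *m s *m Z))).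
  move=> t's st'.
  have -> : 1%:M + pi *: (t' *m Y *m s + Z + pi *: (t' *m Y *m s *m Z)) =
      (1%:M + pi *: (t' *m Y *m s)) *m (1%:M + pi *: Z).
    rewrite mulmxDl mulmxDr !mul1mx mulmxDr mulmx1 -scalemxAl -scalemxAr.
    by rewrite !scalerDr !addrA; congr (_ + _); rewrite addrAC.
  rewrite -!mulmxA; congr (_ *m _); rewrite !mulmxA; congr (_ *m _).
  rewrite mulmxDl mulmxDr mulmx1 mul1mx -scalemxAl -scalemxAr !mulmxA.
  by rewrite st' mul1mx.
have := subgroup_mul HS HT; rewrite (expand S T' T X X' TK (mulmx1C TK)).
have := subgroup_mul HT HS; rewrite (expand T S' S X' X SK (mulmx1C SK)).
rewrite -comm => HB HA.
have uP : S *m T \in unitmx.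
  by rewrite unitmx_mul (mulmx1_unit SK).2 (mulmx1_unit TK).2.
set XT := T' *m X *m T in HA *; set XS := S' *m X' *m S in HB *.
rewrite -(@red_piD _ _ l_prime _ (XT *m X' - XS *m X)).
apply: (level_div HA HB uP); first by rewrite mulmxDr mulmx1 -scalemxAr red_piD.
move: (XT *m X') (XS *m X) (S *m T) => Z Z' P.
rewrite expr1 [pi *: (P *m _)]scalemxAr -mulmxDr; congr (_ *m _).
by apply/matrixP => i j; rewrite !mxE; ring.
Qed.

Lemma subgroup_exp A n : H A -> H (A ^+ n).
Proof.
move=> HA; elim: n => [|n IH]; first by case: H_subgroup.
by rewrite exprS; apply: subgroup_mul.
Qed.

(** In the l-th power of [1 + Z], with [Z = l^(k+1) Y], the term [lZ] must dominate. For [l = 2] and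
    [k = 0] the term [Z^2] is a priori of the same order; [C *m C = 0] supplies the missing factor
    [l]. *)
Lemma level_step k C : level k.+1 C -> C *m C = 0 -> level k.+2 C.
Proof.
move=> [Y HY <-]; rewrite -map_mxM => /(padic_mx_res_eq0 l_prime)[W].
rewrite expr1 => YW; set Z := pi ^+ k.+1 *: Y in HY.
have [Q hQ] := exprD1_order3 Z l.
exists (Y + pi ^+ k.+1 *: (W *+ 'C(l, 2) + W *m Z *m Q)); last by rewrite red_piXD.
have := subgroup_exp l HY; rewrite hQ; congr H.
have ZZ : Z *m Z = pi ^+ k.+2 *: (pi ^+ k.+1 *: W).
  by rewrite /Z -scalemxAl -scalemxAr YW !scalerA -!exprD -exprSr.
have -> : Z ^+ 3 * Q = Z *m Z *m Z *m Q by rewrite exprSr expr2.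
rewrite expr2 -[Z * Z]/(Z *m Z) ZZ -[1]/(1%:M) -!addrA; congr (_ + _).
rewrite !scalerDr; congr (_ + (_ + _)).
- by rewrite /Z -scaler_nat scalerA -exprS.
- by rewrite !scalerMnr.
- by rewrite -!scalemxAl.
Qed.

(** The lift is [1 + Z] with [Z = N + l W] not divisible by [l], so [level_step] does not apply.
    Instead [N^2 = 0] makes [Z^2] divisible by [l], and the condition on [form v (X v)] controls the
    next order. *)
Lemma level1_square_form v X (x : 'cV[F]_(g + g)) :
  H (transvection 1 v *m (1%:M + pi *: X)) -> sp (red X) ->
  padic_res 0 (form v (X *m v)) = 0 ->
  exists2 C, level 1 C & form x (C *m x) = - form (red v) x ^+ 2.
Proof.
move def_N: (bil v v) => N; move def_W: (X + N *m X) => W.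
move def_Z: (N + pi *: W) => Z.
have -> : transvection 1 v *m (1%:M + pi *: X) = 1%:M + Z.
  rewrite /transvection def_N scale1r mulmxDr mulmx1 mulmxDl mul1mx -scalemxAr.
  by rewrite -def_Z -def_W scalerDr !addrA.
move=> HZ spX vXv.
have vXv' : form (red v) (red X *m red v) = 0.
  by rewrite -map_mxM map_form; exact: vXv.
have NN : N *m N = 0 by rewrite -def_N bilMbil formvv scale0r.
move def_Z2: (N *m W + W *m N + pi *: (W *m W)) => Z2.
have ZZ : Z *m Z = pi *: Z2.
  rewrite -def_Z -def_Z2 mulmxDl !mulmxDr NN add0r -!scalemxAl -!scalemxAr.
  by rewrite !scalerDr !addrA.
have redN : red N = bil (red v) (red v) by rewrite -def_N map_bil.
(* For l = 2 the square is [1 + 2 (Z + Z2)]; for l odd [l | 'C(l, 2)] and Z^3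
   is divisible by l^2, so the l-th power is [1 + l Z] modulo l^2. *)
have [l2|l_odd] := even_prime l_prime.
  exists (red (Z + Z2)).
    exists (Z + Z2) => //; have := subgroup_mul HZ HZ; congr H.
    rewrite mulmxDl !mulmxDr !mul1mx mulmx1 ZZ expr1 scalerDr.
    by rewrite [pi *: Z]scaler_nat (congr1 (GRing.natmul Z) l2) mulr2n !addrA.
  have -> : red (Z + Z2) = red (N + (N *m W + W *m N)).
    rewrite -def_Z -def_Z2 addrA red_piD //.
    by rewrite addrAC red_piD.
  rewrite !map_mxD !map_mxM -def_W map_mxD map_mxM redN.
  exact: form_square_shear.
have [c] := padic_res_eq0 (prime_gt1 l_prime) vXv; rewrite expr1 => vXvc.
(* [NWN] is [form v (W v)] times [N], and [W] may be replaced by [X] there because [form v v = 0].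
   This makes [Z^3] divisible by [l^2]. *)
have NWN : N *m W *m N = pi *: (c *: N).
  have -> : N *m W *m N = form v (W *m v) *: N.
    apply: mulmx_cV_inj => y; rewrite -!mulmxA -def_N !bilE -scalemxAr formZr.
    by rewrite -scalemxAl bilE scalerA mulrC.
  rewrite scalerA -vXvc -def_W mulmxDl formDr -mulmxA -def_N bilE formZr formvv.
  by rewrite mulr0 addr0.
move def_Z3: (c *: N + N *m W *m W + W *m Z2) => Z3.
have ZZZ : Z *m (Z *m Z) = pi ^+ 2 *: Z3.
  rewrite ZZ -scalemxAr expr2 -scalerA; congr (_ *: _).
  rewrite -{1}def_Z mulmxDl -scalemxAl -def_Z3 !scalerDr; congr (_ + _).
  by rewrite -{1}def_Z2 !mulmxDr !mulmxA NN mul0mx add0r NWN -scalemxAr !mulmxA.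
have [Q hQ] := exprD1_order3 Z l.
have [m binm] : exists m, 'C(l, 2) = (m * l)%N.
  by apply/dvdnP; apply: prime_dvd_bin => //; rewrite odd_prime_gt2.
exists (red (Z + pi *: (Z2 *+ m + Z3 *m Q))).
  exists (Z + pi *: (Z2 *+ m + Z3 *m Q)) => //.
  have := subgroup_exp l HZ; rewrite hQ; congr H.
  have -> : Z ^+ 3 * Q = Z *m (Z *m Z) *m Q by rewrite exprS expr2.
  rewrite expr2 -[Z * Z]/(Z *m Z) ZZZ ZZ -[1]/(1%:M) -!addrA; congr (_ + _).
  rewrite expr1 !scalerDr; congr (_ + (_ + _)).
  - by rewrite scaler_nat.
  - by rewrite binm mulrnA -scaler_nat scalerMnr.
  - by rewrite -scalemxAl expr2 scalerA.
rewrite red_piD // -def_Z red_piD // redN bilE formZr (formC x); ring.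
Qed.

Lemma red_transvection1 u :
  red (transvection 1 u) = transvection 1 (red u).
Proof. by rewrite map_transvection rmorph1. Qed.

Lemma red_conj_sub S T U X Y Z :
  red ((S *m X *m T - X) - (U *m Y *m Z - Y)) =
  (red S *m red X *m red T - red X) - (red U *m red Y *m red Z - red Y).
Proof. by rewrite !map_mxB !map_mxM. Qed.

(** The element of [level1_commutator] is tested against [y]; invariance of the form turns
    [<y, t^-1 X t y>] into [<t y, X t y>], the shape used in [shear_constraints]. *)
Lemma level1_commutator_form S S' T T' X X' (s t : 'M[F]_(g + g)) y :
  (forall C x, level 1 C -> form x (C *m x) = 0) -> Sp F g s -> Sp F g t ->
  red S = s -> red T = t ->
  S *m T = T *m S -> S' *m S = 1%:M -> T' *m T = 1%:M ->
  H (S *m (1%:M + pi *: X)) -> H (T *m (1%:M + pi *: X')) ->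
  form (t *m y) (red X *m (t *m y)) - form y (red X *m y) =
  form (s *m y) (red X' *m (s *m y)) - form y (red X' *m y).
Proof.
move=> alt Sps Spt Ss Tt comm SK TK HS HT.
apply/eqP; rewrite -subr_eq0; apply/eqP.
have adj (u u' : 'M[F]_(g + g)) x z : Sp F g u -> u' *m u = 1%:M ->
    form x (u' *m z) = form (u *m x) z.
  move=> Spu /mulmx1C uu'; rewrite -(form_mulmx _ _ Spu) mulmxA uu'.
  by rewrite mul1mx.
have sK : red S' *m s = 1%:M by rewrite -Ss -map_mxM SK map_mx1.
have tK : red T' *m t = 1%:M by rewrite -Tt -map_mxM TK map_mx1.
have := alt _ y (level1_commutator comm SK TK HS HT).
rewrite red_conj_sub Ss Tt => <-.
rewrite !mulmxBl -!mulmxA !formDr !formNr !formDr !formNr.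
by rewrite (adj _ _ _ _ Sps sK) (adj _ _ _ _ Spt tK).
Qed.

Lemma level1_non_alternating :
  exists2 C, level 1 C & exists x, form x (C *m x) != 0.
Proof.
apply: contrapT => noC.
have alt C x : level 1 C -> form x (C *m x) = 0.
  by move=> LC; apply: contrapT => /eqP Cx; apply: noC; exists C => //; exists x.
pose e (i : 'I_g) : 'cV[R]_(g + g) := delta_mx (lshift g i) 0.
pose f (i : 'I_g) : 'cV[R]_(g + g) := delta_mx (rshift g i) 0.
have ee i j : form (e i) (e j) = 0 by rewrite form_delta block_mxEul mxE.
have ef i j : form (e i) (f j) = (i == j)%:R.
  by rewrite form_delta block_mxEur mxE.
pose i0 : 'I_g := Ordinal (ltnW g_ge2); pose i1 : 'I_g := Ordinal g_ge2.
have [X HX spX] := lift_transvection (e i0).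
have [X1 HX1 spX1] := lift_transvection (e i1).
have [X2 HX2 spX2] := lift_transvection (e i0 + e i1).
have commutator v w Y Y' y : form v w = 0 ->
    H (transvection 1 v *m (1%:M + pi *: Y)) ->
    H (transvection 1 w *m (1%:M + pi *: Y')) ->
    form (transvection 1 (red w) *m y) (red Y *m (transvection 1 (red w) *m y))
      - form y (red Y *m y) =
    form (transvection 1 (red v) *m y) (red Y' *m (transvection 1 (red v) *m y))
      - form y (red Y' *m y).
  move=> vw HY HY'; exact: (@level1_commutator_form _ _ _ _ Y Y' _ _ y alt
    (transvection_Sp 1 (red v))
    (transvection_Sp 1 (red w)) (red_transvection1 v) (red_transvection1 w)
    (transvectionC 1 1 vw) (mulmx1C (transvectionK 1 v))
    (mulmx1C (transvectionK 1 w)) HY HY').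
have X0 : form (red (e i0)) (red X *m red (e i0)) = 0.
  (* The test vector [f i1] is dual to [e i1] and orthogonal to [e i0]. *)
  apply: (@shear_vanish (Zl_field l_prime) g (red X) (red X1) (red X2)
    (red (e i0)) (red (e i1)) (red (f i1)) spX spX1 spX2).
  - by move=> y; exact: commutator.
  - move=> y; rewrite -map_mxD; apply: commutator => //.
    by rewrite formDr !ee addr0.
  - by rewrite map_form ee rmorph0.
  - by rewrite map_form ef rmorph0.
  - by rewrite map_form ef rmorph1.
rewrite -map_mxM map_form in X0.
(* At [f i0], which is dual to [e i0], the form takes the value -1. *)
have [C LC Cx] := level1_square_form (red (f i0)) HX spX X0.
have := alt C (red (f i0)) LC; rewrite Cx map_form ef eqxx rmorph1 expr1n.
by move/eqP; rewrite oppr_eq0 oner_eq0.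
Qed.

(** Level 1 comes from a non-alternating element. Afterwards a single nonzero square [bil v v],
    pushed up by [level_step], generates the next level. *)
Lemma level_full k C : sp C -> level k.+1 C.
Proof.
have LD n := @levelD n; have LZ n := @levelZ n.
have LJ n t D : Sp F g t -> level n.+1 D -> level n.+1 (t *m D *m invmx t).
  exact: level_conj.
elim: k C => [|k IH] C spC.
  have [D LD1 [x Dx]] := level1_non_alternating.
  exact: (@sp_full (Zl_field l_prime) g (level 1) (LD 0%N) (LZ 0%N) (LJ 0%N)
    D x g_ge2 LD1 (level_sp LD1) Dx C spC).
pose v : 'cV[F]_(g + g) := delta_mx (lshift g (Ordinal (ltnW g_ge2))) 0.
have v0 : v != 0.
  apply/eqP => /matrixP/(_ (lshift g (Ordinal (ltnW g_ge2))) 0) /eqP.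
  by rewrite !mxE !eqxx oner_eq0.
have Lv : level k.+2 (bil v v).
  apply: level_step; last by rewrite bilMbil formvv scale0r.
  by apply: IH; exact: sp_bil.
exact: (@sp_mem (Zl_field l_prime) g (level k.+2) (LD k.+1) (LZ k.+1) (LJ k.+1)
  C v Lv v0 spC).
Qed.

(** * Successive approximation and density *)

Lemma invmx_Sp A : Sp R g A -> Sp R g (invmx A).
Proof.
move=> SpA; have uA := Sp_unitmx SpA; case: SpA => dA OA; split.
  by rewrite det_inv dA invr1.
by rewrite -[in LHS]OA !mulmxA -trmx_mul mulmxV // trmx1 mul1mx mulmxK.
Qed.

(** [M] is lifted entrywise to some [B], symplectic only modulo [l^(k+2)], and [A] in [H] agrees
    with [B] modulo [l^(k+1)] by induction. The correction [A^-1 B = 1 + l^(k+1) Y] has the residue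
    of [Y] in [sp], so [level_full] replaces it by an element of [H] without changing the
    reduction. *)
Lemma mod_reduction_Sp k : mod_reduction k H = Sp 'Z_(l ^ k.+1) g.
Proof.
elim: k => [|k IH]; first exact: H_mod_l.
apply/seteqP; split=> [_ [A HA <-]|M [dM OM]].
  by apply: map_Sp; exact: subgroup_Sp.
have [B BM] : exists B : 'M[R]_(g + g), map_mx (@padic_res l k.+1) B = M.
  exists (\matrix_(i, j) projT1 (cid (padic_res_surj (M i j)))).
  by apply/matrixP => i j; rewrite !mxE; case: cid.
have [Q BQ] : exists Q : 'M[R]_(g + g),
    B^T *m Omega R g *m B - Omega R g = pi ^+ k.+2 *: Q.
  apply: (padic_mx_res_eq0 l_prime).
  by rewrite map_mxB !map_mxM -map_trmx !map_Omega BM OM subrr.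
have [A HA AB] : mod_reduction k H (map_mx (@padic_res l k) B).
  rewrite IH; split.
    apply/eqP; rewrite det_map_mx -subr_eq0 -(rmorph1 (@padic_res l k)) -rmorphB.
    by apply/eqP/padic_res_pred; rewrite rmorphB rmorph1 /= -det_map_mx BM dM subrr.
  apply/eqP; rewrite -subr_eq0 -(map_Omega _ (@padic_res l k)) map_trmx.
  by rewrite -!map_mxM -map_mxB BQ exprSr -scalerA map_mxZ /= res_piX // scale0r.
have SpA := subgroup_Sp HA; have uA := Sp_unitmx SpA.
have [Y AY] : exists Y : 'M[R]_(g + g), invmx A *m B - 1%:M = pi ^+ k.+1 *: Y.
  apply: (padic_mx_res_eq0 l_prime).
  by rewrite map_mxB map_mxM -AB -map_mxM mulVmx // subrr.
have EY : 1%:M + pi ^+ k.+1 *: Y = invmx A *m B by rewrite -AY addrC subrK.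
have BE : B = A *m (1%:M + pi ^+ k.+1 *: Y) by rewrite EY mulKVmx.
have spY : sp (red Y).
  apply: (@sp_red _ _ l_prime k Y Q); rewrite EY -BQ [RHS]addrC subrK.
  have [_ OA] := invmx_Sp SpA.
  rewrite trmx_mul -!mulmxA (mulmxA (Omega R g)) (mulmxA (invmx A)^T).
  by rewrite (mulmxA _ (Omega R g) (invmx A)) OA.
have [Y' HY' YY] := level_full k spY.
exists (A *m (1%:M + pi ^+ k.+1 *: Y')); first exact: subgroup_mul.
have [Z YZ] : exists Z : 'M[R]_(g + g), Y' - Y = pi ^+ 1 *: Z.
  by apply: (padic_mx_res_eq0 l_prime); rewrite map_mxB YY subrr.
rewrite -BM BE !map_mxM; congr (_ *m _).
rewrite -[Y'](subrK Y) YZ scalerDr scalerA -exprD addn1 addrCA map_mxD map_mxZ.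
by rewrite [X in X *: _]res_piX // scale0r add0r.
Qed.

Lemma dense_in_Sp M k : Sp R g M ->
  exists2 A, H A & forall i j, padic_coset (M i j) k.+1 (A i j).
Proof.
move=> SpM; have [A HA AM] : mod_reduction k H (map_mx (@padic_res l k) M).
  by rewrite mod_reduction_Sp; exact: map_Sp.
exists A => // i j; have [Z AZ] : exists Z : 'M[R]_(g + g),
    A - M = pi ^+ k.+1 *: Z.
  by apply: (padic_mx_res_eq0 l_prime); rewrite map_mxB AM subrr.
exists (Z i j) => //; move/matrixP/(_ i j): AZ; rewrite !mxE => <-.
by rewrite [LHS]addrC subrK.
Qed.

End LevelSubgroups.

Theorem theorem1 (g l : nat) (g_ge2 : (2 <= g)%N) (l_prime : prime l)
    (H : set 'M[padic_int l]_(g + g))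
    (H_subgroup : is_subgroup_Sp H)
    (H_closed : is_closed_in_Sp H)
    (H_mod_l : mod_reduction 0 H = Sp 'Z_(l ^ 1) g) :
  H = Sp (padic_int l) g /\
  (forall k : nat, mod_reduction k H = Sp 'Z_(l ^ k.+1) g).
Proof.
split; last exact: mod_reduction_Sp.
apply/seteqP; split=> [M HM|M SpM]; first exact: subgroup_Sp HM.
apply: H_closed => B nB.
(* A neighbourhood of [M] in the subspace contains the trace on [Sp] of a box [P] of entrywise
   neighbourhoods. *)
have [P MP PB] : within (Sp (padic_int l) g) (nbhs M) B.
  by rewrite (nbhs_subspace_in SpM).
have MPk i j : exists k, padic_coset (M i j) k `<=` P i j.
  by have [k _ kP] := MP i j; exists k.
pose K i j := projT1 (cid (MPk i j)).
(* There are finitely many entries, so one precision serves them all. *)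
pose m := \max_i \max_j K i j.
have [A HA AM] := dense_in_Sp l_prime g_ge2 H_subgroup H_mod_l m SpM.
exists A; split=> //; apply: PB; last exact: subgroup_Sp HA.
move=> i j; rewrite /=; apply: (projT2 (cid (MPk i j))).
apply: padic_coset_le (AM i j); apply: leqW.
exact: leq_trans (leq_bigmax j) (leq_bigmax i).
Qed.
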